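(* For each integer $t\ge 2$ there is a positive constant $C=C(t)$ such that for all sufficiently large $n$, $$C n^{1/3} \le f(n,K_{2,t}) \le (2+o(1))\, n^{1/3},$$ where $o(1)$ denotes a quantity tending to $0$ as $n\to\infty$. In particular, $$(1-o(1))\,n^{1/3} \le f(n,C_4) \le (2+o(1))\, n^{1/3}.$$
   Context: $K_{2,t}$ is the complete bipartite graph with parts of sizes $2$ and $t$, and $C_4$ is the cycle on $4$ vertices. For positive integers $n,k$, an $(n,k)$-graph is a graph whose vertex set is a disjoint union of $n$ parts, each of size at most $k$, with no edges inside a part and exactly one edge between any two distinct parts. For a graph $H$, $f(n,H)=\min\{k\in\mathbb N : \text{there is an } (n,k)\text{-graph containing no subgraph isomorphic to } H\}$. *)

(* Defs.v *)
From mathcomp Require Import all_boot all_order all_algebra.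
From mathcomp Require Import boolp.

Set Implicit Arguments.
Unset Strict Implicit.
Unset Printing Implicit Defensive.

Record sgraph := SGraph {
  vertex :> finType;
  adj : rel vertex;
  adj_sym : symmetric adj;
  adj_irrefl : irreflexive adj
}.

(* The copy of H in G need not be induced. *)
Definition contains_subgraph (G H : sgraph) : Prop :=
  exists phi : H -> G,
    injective phi /\ forall x y : H, adj x y -> adj (phi x) (phi y).

Definition Kadj (s t : nat) : rel ('I_s + 'I_t)%type :=
  fun u v => match u, v with
             | inl _, inr _ | inr _, inl _ => true
             | _, _ => false
             end.

Lemma Kadj_sym s t : symmetric (@Kadj s t).
Proof. by move=> [?|?] [?|?]. Qed.

Lemma Kadj_irrefl s t : irreflexive (@Kadj s t).
Proof. by case. Qed.

Definition Kbip (s t : nat) : sgraph :=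
  SGraph (@Kadj_sym s t) (@Kadj_irrefl s t).

Definition C4adj : rel 'I_4 := fun u v => (v == ordS u) || (u == ordS v).

Lemma C4adj_sym : symmetric C4adj.
Proof. by move=> u v; rewrite /C4adj orbC. Qed.

Lemma C4adj_irrefl : irreflexive C4adj.
Proof. by case=> [[|[|[|[|m]]]] lt_m]. Qed.

Definition C4 : sgraph := SGraph C4adj_sym C4adj_irrefl.

(* Each edge between the distinct parts i and j corresponds to exactly one
   ordered pair (u, v) with u in part i and v in part j. *)
Definition nk_graph (n k : nat) (G : sgraph) : Prop :=
  exists part : G -> 'I_n,
    [/\ forall i : 'I_n, #|[set v | part v == i]| <= k,
        forall u v : G, part u = part v -> ~~ adj u v &
        forall i j : 'I_n, i != j ->
          #|[set uv : G * G |
              [&& part uv.1 == i, part uv.2 == j & adj uv.1 uv.2]]| = 1].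

Definition nk_free (n : nat) (H : sgraph) (k : nat) : Prop :=
  0 < k /\ exists G : sgraph, nk_graph n k G /\ ~ contains_subgraph G H.

(* The least k with nk_free n H k. The value 0 is a default for the case where
   there is no such k (e.g. H a single edge, n >= 2). nk_free_Kbip2 below rules
   this out for n > 0 and H = K_{2,t}, t >= 2, in particular for K_{2,2}, which
   is isomorphic to C4. *)
Definition f (n : nat) (H : sgraph) : nat :=
  if pselect (exists k, (fun k => `[< nk_free n H k >]) k) is left ex
  then ex_minn ex else 0.

Lemma f_min n H k :
  nk_free n H k -> nk_free n H (f n H) /\ f n H <= k.
Proof.
move=> Hk; rewrite /f; case: pselect => [ex|[]]; last by exists k; apply/asboolP.
by case: ex_minnP => m /asboolP Hm min_m; split=> //; apply/min_m/asboolP.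
Qed.

Definition matchadj n : rel ('I_n * 'I_n)%type :=
  fun u v => (u.1 != v.1) && (u == (v.2, v.1)).

Lemma matchadj_sym n : symmetric (@matchadj n).
Proof.
move=> [a b] [c d]; rewrite /matchadj /= !xpair_eqE eq_sym.
by rewrite (eq_sym c b) (eq_sym d a) [(b == c) && _]andbC.
Qed.

Lemma matchadj_irrefl n : irreflexive (@matchadj n).
Proof. by move=> u; rewrite /matchadj eqxx. Qed.

Lemma nk_free_Kbip2 n t : 0 < n -> 1 < t -> nk_free n (Kbip 2 t) n.
Proof.
move=> n_gt0 t_gt1; split=> //.
exists (SGraph (@matchadj_sym n) (@matchadj_irrefl n)); split.
- exists (fun u : 'I_n * 'I_n => u.1); split.
  + move=> i; rewrite -[X in _ <= X]card_ord.
    rewrite -(@card_in_imset _ _ (fun u : 'I_n * 'I_n => u.2)) ?max_card //.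
    by move=> [a b] [c d]; rewrite !inE /= => /eqP -> /eqP -> ->.
  + by move=> u v /= uv; rewrite /matchadj uv eqxx.
  + move=> i j neq_ij; rewrite -(cards1 ((i, j), (j, i))); congr #|pred_of_set _|.
    apply/setP=> -[[a b] [c d]]; rewrite !inE /= /matchadj !xpair_eqE /=.
    apply/idP/idP.
      by case/and3P=> /eqP-> /eqP-> /and3P[_ /eqP<- /eqP->]; rewrite !eqxx.
    by case/andP=> /andP[/eqP-> /eqP->] /andP[/eqP-> /eqP->]; rewrite !eqxx neq_ij.
- move=> [phi [phi_inj phi_adj]].
  have t_gt0 : 0 < t by apply: ltnW.
  pose y : Kbip 2 t := inr (Ordinal t_gt0).
  have A b : phi (inl b) = ((phi y).2, (phi y).1).
    by have /andP[_ /eqP] := phi_adj (inl b) y isT.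
  have := A ord_max; rewrite -(A ord0) => /phi_inj.
  by case.
Qed.

(* Main.v *)
Require Import Defs.
From mathcomp Require Import all_boot all_order all_algebra.
From mathcomp Require Import all_classical all_reals all_analysis.
From mathcomp Require Import finfield ring lra zify.

Set Implicit Arguments.
Unset Strict Implicit.
Unset Printing Implicit Defensive.

(** Lower bound: if two vertices of an (n, k)-graph with N <= n k vertices have
    at most m common neighbours, then counting paths of length two and applying
    Cauchy-Schwarz to the degrees, whose sum is E = n (n - 1), gives
    E ^ 2 <= N (E + m N ^ 2), hence n <= m (k + 1) ^ 3.

    Upper bound: superfluous edges can be removed, so it suffices to find a
    C4-free graph with at least one edge between any two parts.  Let K be the
    field with p = 2 ^ j elements and L its quadratic extension.  On L * L the
    relation y + b = a x between (x, y) and (a, b) is C4-free.  Cut each fibre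
    {x} * L into the p cosets of a K-line whose slope is the first coordinate
    x.1; this gives p ^ 3 parts of size p, and two parts of different slopes are
    joined by a unique edge since their K-lines span L.  The p ^ 2 parts of a
    given slope are joined recursively, on new vertices: this costs only
    O(p ^ (2/3)) more vertices per part.  Hence f(8 ^ j) <= (1 + o(1)) 2 ^ j, and
    rounding n up to a power of 8 costs a factor at most 2. *)

Import Order.TTheory GRing.Theory Num.Theory numFieldNormedType.Exports.

(** * C4-free relations that link all pairs of parts *)

(** Loops count and [u] may equal [v], so this is stronger than having no 4-cycle. *)
Definition c4_free (V : Type) (e : rel V) : Prop :=
  forall u u' v v' : V,
    e u v -> e u v' -> e u' v -> e u' v' -> u = u' \/ v = v'.

(** [I] indexes the parts and [T] the vertices of each part. Surplus edges, also inside a part, are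
    allowed; [thinned] removes them later. *)
Definition linked (I T : finType) : Prop :=
  exists e : rel (I * T),
    [/\ symmetric e, c4_free e &
        forall i j, i != j -> exists s t, e (i, s) (j, t)].

Lemma linked_inj (I J T : finType) (h : J -> I) :
  injective h -> linked I T -> linked J T.
Proof.
move=> h_inj [e [e_sym e_free e_link]].
exists (fun u v => e (h u.1, u.2) (h v.1, v.2)); split.
- by move=> u v; rewrite e_sym.
- move=> [i s] [i' s'] [j t] [j' t'] /= e1 e2 e3 e4.
  by case: (e_free _ _ _ _ e1 e2 e3 e4) => -[/h_inj -> ->]; [left|right].
- move=> i j ij; have [|s [t st]] := e_link (h i) (h j).
    by rewrite (inj_eq h_inj).
  by exists s, t.
Qed.

Lemma linked_card (I J T : finType) :
  (#|J| <= #|I|)%N -> linked I T -> linked J T.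
Proof.
move=> le_JI; apply: (@linked_inj _ _ _
  (fun j => enum_val (widen_ord le_JI (enum_rank j)))).
by move=> i j /enum_val_inj [] /ord_inj /enum_rank_inj.
Qed.

Lemma linked_refl (I : finType) : linked I I.
Proof.
exists (fun u v => u == (v.2, v.1)); split.
- by move=> [a b] [c d] /=; rewrite !xpair_eqE andbC (eq_sym b) (eq_sym a).
- by move=> u u' v v' /eqP-> _ /eqP-> _; left.
- by move=> i j _; exists j, i => /=.
Qed.

(** * The point-line graph over a quadratic extension *)

Section QuadraticExtension.

Variables (K : finFieldType) (d : K).
Hypothesis d_irr : forall x : K, (x ^+ 2 + x != d)%R.

Local Open Scope ring_scope.

(* Multiplication in K[w] with w ^ 2 + w = d, in the basis (1, w). *)
Let mul1 (p q : K * K) : K := p.1 * q.1 + d * (p.2 * q.2).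
Let mul2 (p q : K * K) : K := p.1 * q.2 + p.2 * q.1 - p.2 * q.2.

(** The form is the norm of [q.1 + q.2 w]; a zero with [q.2 != 0] would make [- q.1 / q.2] a root of
    [x ^+ 2 + x = d]. *)
Lemma quadratic_norm_eq0 (q : K * K) :
  q.1 ^+ 2 - q.1 * q.2 - d * q.2 ^+ 2 = 0 -> q = (0, 0).
Proof.
case: q => q1 q2 /= Nq; have [q20|q2_neq0] := eqVneq q2 0.
  by move: Nq; rewrite q20 mulr0 expr0n /= mulr0 !subr0 => /eqP;
    rewrite expf_eq0 /= => /eqP->.
case/eqP: (d_irr (- q1 / q2)); apply: (mulIf (expf_neq0 2 q2_neq0)).
rewrite -[RHS]add0r -Nq; field; exact: q2_neq0.
Qed.

(** Multiplying the product by the conjugate [(q.1 - q.2) - q.2 w] of [q] leaves [p] times the norm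
    of [q]. *)
Lemma quadratic_mul_eq0 (p q : K * K) :
  mul1 p q = 0 -> mul2 p q = 0 -> p = (0, 0) \/ q = (0, 0).
Proof.
rewrite /mul1 /mul2; case: p q => [p1 p2] [q1 q2] /= E1 E2.
have [/(quadratic_norm_eq0 (q := (q1, q2))) ->|N_neq0] :=
  eqVneq (q1 ^+ 2 - q1 * q2 - d * q2 ^+ 2) 0; first by right.
left; congr pair; apply: (mulfI N_neq0); rewrite mulr0.
  by transitivity ((q1 - q2) * (p1 * q1 + d * (p2 * q2))
    - d * q2 * (p1 * q2 + p2 * q1 - p2 * q2)); [ring | rewrite E1 E2; ring].
by transitivity (q1 * (p1 * q2 + p2 * q1 - p2 * q2)
    - q2 * (p1 * q1 + d * (p2 * q2))); [ring | rewrite E1 E2; ring].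
Qed.

(* ((x, h), s) encodes the vertex (x, y) of the graph y + b = a x with
   y = (s, x.1 * s + h): the part (x, h) is a coset of the line of slope x.1. *)
Definition point_line (u v : K * K * K * K) : bool :=
  let: (x, h, s) := u in let: (a, g, r) := v in
  (s + r == mul1 a x) && (x.1 * s + h + (a.1 * r + g) == mul2 a x).

Arguments point_line : simpl never.

Lemma point_line_sym : symmetric point_line.
Proof.
move=> [[x h] s] [[a g] r]; rewrite /point_line /mul1 /mul2.
congr andb; first by congr eq_op; ring.
by congr eq_op; ring.
Qed.

(** The four equations combine to [(a - a') (x - x') = 0] in the extension, which has no zero
    divisors. If [x = x'], a common neighbour determines the rest ([same]). *)
Lemma point_line_c4_free : c4_free point_line.
Proof.
have same x h h' s s' v : point_line (x, h, s) v -> point_line (x, h', s') v ->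
    (x, h, s) = (x, h', s').
  case: v => [[a g] r] /andP[/eqP E1 /eqP E2] /andP[/eqP F1 /eqP F2].
  have ss' : s = s' by apply: (addIr r); rewrite E1 F1.
  move: E2; rewrite -F2 -ss' => /addIr /addrI ->; congr (_, _, _); exact: ss'.
move=> [[x h] s] [[x' h'] s'] [[a g] r] [[a' g'] r'] e1 e2 e3 e4.
have eqP2 (p q : K * K) : (p.1 - q.1, p.2 - q.2) = (0, 0) -> p = q.
  by case: p q => [? ?] [? ?] /= [/subr0_eq -> /subr0_eq ->].
have [] := @quadratic_mul_eq0 (a.1 - a'.1, a.2 - a'.2) (x.1 - x'.1, x.2 - x'.2).
- move/andP: e1 e2 e3 e4 => [/eqP E1 _] /andP[/eqP E2 _] /andP[/eqP E3 _].
  move=> /andP[/eqP E4 _].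
  transitivity (mul1 a x - mul1 a' x - (mul1 a x' - mul1 a' x')).
    by rewrite /mul1 /=; ring.
  by rewrite -E1 -E2 -E3 -E4; ring.
- move/andP: e1 e2 e3 e4 => [_ /eqP E1] /andP[_ /eqP E2] /andP[_ /eqP E3].
  move=> /andP[_ /eqP E4].
  transitivity (mul2 a x - mul2 a' x - (mul2 a x' - mul2 a' x')).
    by rewrite /mul2 /=; ring.
  by rewrite -E1 -E2 -E3 -E4; ring.
- move=> /eqP2 aa'; right; move: e1 e2; rewrite -aa' !(point_line_sym (x, h, s)).
  exact: same.
- by move=> /eqP2 xx'; left; move: e1 e3; rewrite -xx'; apply: same.
Qed.

(** The conditions are two linear equations in [s] and [r] with determinant [x.1 - a.1] up to
    sign. *)
Lemma point_line_link (x a : K * K) (h g : K) : x.1 != a.1 ->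
  exists s r, point_line (x, h, s) (a, g, r).
Proof.
move=> xa; have xa0 : x.1 - a.1 != 0 by rewrite subr_eq0.
pose s := (mul2 a x - h - g - a.1 * mul1 a x) / (x.1 - a.1).
exists s, (mul1 a x - s); apply/andP; split; first by apply/eqP; ring.
by apply/eqP; rewrite /s; field.
Qed.

(* Parts with the same slope c are linked through a copy of the given graph on
   new vertices, one copy for each c. *)
Lemma linked_cube (T : finType) :
  linked (K * K)%type T -> linked (K * K * K)%type (K + T)%type.
Proof.
move=> [e [e_sym e_free e_link]].
pose E (u v : K * K * K * (K + T)) : bool :=
  match u.2, v.2 with
  | inl s, inl r => point_line (u.1, s) (v.1, r)
  | inr s, inr r => (u.1.1.1 == v.1.1.1) &&
      e (u.1.1.2, u.1.2, s) (v.1.1.2, v.1.2, r)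
  | _, _ => false
  end.
exists E; split.
- move=> [i [s|s]] [j [r|r]] //; rewrite /E /=; first exact: point_line_sym.
  by rewrite e_sym eq_sym.
(* No edge joins an old vertex to a new one, so all four are of one kind; new ones also share their
   slope. *)
- move=> [i [s|s]] [i' [s'|s']] [j [r|r]] [j' [r'|r']] //; rewrite /E /=.
    move=> e1 e2 e3 e4.
    by case: (point_line_c4_free e1 e2 e3 e4) => -[-> ->]; [left|right].
  case: i i' j j' => [[? ?] ?] [[? ?] ?] [[? ?] ?] [[? ?] ?] /=.
  move=> /andP[/eqP -> e1] /andP[/eqP <- e2] /andP[/eqP -> e3] /andP[_ e4].
  by case: (e_free _ _ _ _ e1 e2 e3 e4) => -[-> -> ->]; [left|right].
- move=> [[x1 x2] h] [[a1 a2] g]; have [<- neq|xa _] := eqVneq x1 a1.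
    have [|s [r]] := e_link (x2, h) (a2, g).
      by apply: contra_neq neq => -[-> ->].
    by exists (inr s), (inr r); rewrite /E /= eqxx.
  have [s [r]] := @point_line_link (x1, x2) (a1, a2) h g xa.
  by exists (inl s), (inl r).
Qed.

End QuadraticExtension.

(* The map x |-> x ^ 2 + x identifies 0 and -1, so it is not onto. *)
Lemma quadratic_nonvalue (K : finFieldType) :
  exists d : K, forall x : K, (x ^+ 2 + x != d)%R.
Proof.
pose q (x : K) := (x ^+ 2 + x)%R.
have [/existsP[d /forallP dP]|all_val] := boolP [exists d, forall x, q x != d].
  by exists d.
have q_onto y : exists x, q x = y.
  move: all_val; rewrite negb_exists => /forallP /(_ y); rewrite negb_forall.
  by move=> /existsP[x /negPn/eqP]; exists x.
pose g y := sval (cid (q_onto y)).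
have gK : cancel g q by move=> y; exact: (svalP (cid (q_onto y))).
have qK := canF_sym gK.
have : (0 = -1 :> K)%R by rewrite -(qK 0%R) -(qK (-1)%R) /q; congr g; ring.
by move/eqP; rewrite eq_sym oppr_eq0 oner_eq0.
Qed.

(** * Recursion along the powers of 8 *)

Lemma linked_exp8_step (j : nat) (I T : finType) : (0 < j)%N ->
  (4 ^ j <= #|I|)%N -> linked I T ->
  exists2 T' : finType, (#|T'| = 2 ^ j + #|T|)%N & linked 'I_(8 ^ j) T'.
Proof.
move=> j_gt0 le_I IT.
have [K _ cardK] := pPrimePowerField (isT : prime 2) j_gt0.
have [d dP] := quadratic_nonvalue K.
have KT : linked (K * K)%type T.
  by apply: linked_card IT; rewrite card_prod cardK -expnMn.
exists (K + T)%type; first by rewrite card_sum cardK.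
apply: linked_card (linked_cube dP KT).
by rewrite card_ord !card_prod cardK -!expnMn.
Qed.

(** Induction from [j - 1], as [4 ^ j <= 8 ^ (j - 1)] for [j >= 3]; the step costs
    [2 ^ j + 16 * 2 ^ (j - 1) = 9 * 2 ^ j]. *)
Lemma linked_exp8_weak (j : nat) :
  exists2 T : finType, (#|T| <= 16 * 2 ^ j)%N & linked 'I_(8 ^ j) T.
Proof.
elim/ltn_ind: j => j IH; have [j_lt3|j_ge3] := ltnP j 3.
  (* The constant 16 comes from [j = 2], where this uses [64 = 16 * 2 ^ 2] vertices per part. *)
  exists 'I_(8 ^ j); last exact: linked_refl.
  by rewrite card_ord; case: j j_lt3 {IH} => [|[|[|]]].
have [|T cardT linkT] := IH j.-1; first by lia.
have [| |T' cardT' linkT'] := linked_exp8_step (j := j) _ _ linkT.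
- by lia.
- rewrite card_ord -[4%N]/(2 ^ 2)%N -[8%N]/(2 ^ 3)%N -!expnM leq_exp2l //; lia.
exists T' => //; rewrite cardT'; have -> : (2 ^ j = 2 * 2 ^ j.-1)%N.
  by rewrite -expnS prednK //; lia.
lia.
Qed.

(** The inner exponent is [2 j / 3] rounded up, the least [i] with [4 ^ j <= 8 ^ i]. *)
Lemma linked_exp8 (j : nat) : (0 < j)%N ->
  exists2 T : finType, (#|T| <= 2 ^ j + 16 * 2 ^ ((2 * j + 2) %/ 3))%N
    & linked 'I_(8 ^ j) T.
Proof.
move=> j_gt0; have [T cardT linkT] := linked_exp8_weak ((2 * j + 2) %/ 3).
have [|T' cardT' linkT'] := linked_exp8_step j_gt0 _ linkT.
  by rewrite card_ord -[4%N]/(2 ^ 2)%N -[8%N]/(2 ^ 3)%N -!expnM leq_exp2l //; lia.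
by exists T' => //; rewrite cardT' leq_add2l.
Qed.

(** * From linked families to (n, k)-graphs *)

Definition has_c4 (H : sgraph) : Prop :=
  exists x x' y y' : H, [/\ x != x', y != y', adj x y, adj x y' &
    adj x' y /\ adj x' y'].

Lemma has_c4_Kbip2 (t : nat) : (1 < t)%N -> has_c4 (Kbip 2 t).
Proof.
move=> t_gt1; exists (inl ord0), (inl ord_max).
by exists (inr (Ordinal (ltnW t_gt1))), (inr (Ordinal t_gt1)).
Qed.

Lemma has_c4_C4 : has_c4 C4.
Proof.
exists (@Ordinal 4 0 isT), (@Ordinal 4 2 isT).
by exists (@Ordinal 4 1 isT), (@Ordinal 4 3 isT).
Qed.

Section Thinning.

Variables (n : nat) (T : finType) (e : rel ('I_n * T)).

(** The condition [u.1 < v.1] makes one choice per unordered pair of parts, so symmetrizing adds no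
    second edge. *)
Let chosen (u v : 'I_n * T) : bool :=
  (u.1 < v.1)%N &&
  ([pick p : T * T | e (u.1, p.1) (v.1, p.2)] == Some (u.2, v.2)).

Definition thinned (u v : 'I_n * T) : bool := chosen u v || chosen v u.

Lemma thinned_sym : symmetric thinned.
Proof. by move=> u v; rewrite /thinned orbC. Qed.

Lemma thinned_irrefl : irreflexive thinned.
Proof. by move=> u; rewrite /thinned /chosen ltnn. Qed.

Lemma thinned_sub : symmetric e -> subrel thinned e.
Proof.
move=> e_sym [i s] [j t]; rewrite /thinned /chosen /=.
case/orP=> /andP[_]; case: pickP => //= -[a b] /= eab /eqP[<- <-] //.
by rewrite e_sym.
Qed.

Lemma card_thinned (i j : 'I_n) : i != j ->
  (forall i j, i != j -> exists s t, e (i, s) (j, t)) ->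
  #|[set uv | [&& uv.1.1 == i, uv.2.1 == j & thinned uv.1 uv.2]]| = 1%N.
Proof.
move=> neq_ij e_link; rewrite /thinned /chosen.
have pick_ex a b : a != b ->
    exists p, [pick p : T * T | e (a, p.1) (b, p.2)] = Some p.
  move=> /e_link [s [t st]]; case: pickP => [p _|/(_ (s, t))]; first by exists p.
  by rewrite st.
have [lt_ij|] := ltnP i j.
  have [[s t] def_p] := pick_ex i j neq_ij.
  rewrite -(cards1 ((i, s), (j, t))); congr #|pred_of_set _|.
  apply/setP => -[[a b] [c d]]; rewrite !inE /= !xpair_eqE.
  have [->|_] := eqVneq a i => //=.
  have [->|_] := eqVneq c j => //=; last by rewrite andbF.
  rewrite lt_ij def_p [(j < i)%N]ltnNge ltnW //= orbF.
  by apply/eqP/andP => [[-> ->]|[/eqP-> /eqP->]].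
rewrite leq_eqVlt val_eqE eq_sym (negPf neq_ij) /= => lt_ji.
have [[s t] def_p] := pick_ex j i (contra_neq esym neq_ij).
rewrite -(cards1 ((i, t), (j, s))); congr #|pred_of_set _|.
apply/setP => -[[a b] [c d]]; rewrite !inE /= !xpair_eqE.
have [->|_] := eqVneq a i => //=.
have [->|_] := eqVneq c j => //=; last by rewrite andbF.
rewrite lt_ji def_p [(i < j)%N]ltnNge ltnW //=.
by apply/eqP/andP => [[-> ->]|[/eqP-> /eqP->]].
Qed.

End Thinning.

Lemma linked_nk_free (n k : nat) (T : finType) (H : sgraph) :
  has_c4 H -> (0 < k)%N -> (#|T| <= k)%N -> linked 'I_n T -> nk_free n H k.
Proof.
move=> [x [x' [y [y' [xx' yy' xy xy' [x'y x'y']]]]]] k_gt0 cardT.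
move=> [e [e_sym e_free e_link]]; split=> //.
exists (SGraph (@thinned_sym _ _ e) (@thinned_irrefl _ _ e)); split.
  exists (fun u : 'I_n * T => u.1); split.
  - move=> i; apply: leq_trans cardT.
    rewrite -(@card_in_imset _ _ (fun u : 'I_n * T => u.2)) ?max_card //.
    by move=> [a b] [c d]; rewrite !inE /= => /eqP -> /eqP -> ->.
  - by move=> u v /= uv; rewrite /thinned uv ltnn.
  - by move=> i j neq_ij; exact: card_thinned.
move=> [phi [phi_inj phi_adj]].
have sub a b : adj a b -> e (phi a) (phi b).
  by move/phi_adj; apply: thinned_sub.
case: (e_free _ _ _ _ (sub _ _ xy) (sub _ _ xy') (sub _ _ x'y) (sub _ _ x'y')).
  by move/phi_inj/eqP; apply/negP.
by move/phi_inj/eqP; apply/negP.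
Qed.

(** * Lower bound by counting common neighbours *)

Definition codegree (G : sgraph) (u v : G) : nat :=
  #|[set w | adj u w && adj v w]|.

Lemma codegree_Kbip2_free (t : nat) (G : sgraph) (u v : G) :
  ~ contains_subgraph G (Kbip 2 t.+1) -> u != v -> (codegree u v <= t)%N.
Proof.
move=> freeG uv; rewrite leqNgt; apply/negP => lt_t; apply: freeG.
pose w (i : 'I_t.+1) := enum_val (widen_ord lt_t i).
have wP i : adj u (w i) && adj v (w i).
  by have := enum_valP (widen_ord lt_t i); rewrite inE.
pose phi (z : 'I_2 + 'I_t.+1) := match z with
  | inl i => if i == ord0 then u else v | inr i => w i end.
have w_adj i j : adj (phi (inl i)) (w j).
  by rewrite /=; case: ifP => _; have /andP[] := wP j.
exists phi; split; last first.
  by move=> [i|i] [j|j] //= _; [|rewrite adj_sym]; apply: w_adj.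
have neq i j : phi (inl i) != w j.
  by apply/eqP => E; have := w_adj i j; rewrite E adj_irrefl.
move=> [i|i] [j|j].
- move=> /= E; congr inl; apply: ord_inj; move: E uv.
  by case: i j => [[|[|]] //= ?] [[|[|]] //= ?] => ->; rewrite eqxx.
- by move/eqP; rewrite (negPf (neq _ _)).
- by move/esym/eqP; rewrite (negPf (neq _ _)).
- by move=> /enum_val_inj[] /ord_inj ->.
Qed.

Lemma codegree_C4_free (G : sgraph) (u v : G) :
  ~ contains_subgraph G C4 -> u != v -> (codegree u v <= 1)%N.
Proof.
move=> freeG uv; rewrite leqNgt; apply/negP => /card_gt1P [a [b []]].
rewrite !inE => /andP[ua va] /andP[ub vb] ab; apply: freeG.
have neq (x y : G) : adj x y -> x != y.
  by move=> xy; apply/eqP => E; move: xy; rewrite E adj_irrefl.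
exists (fun i : 'I_4 => nth u [:: u; a; v; b] i); split.
  move=> i j /eqP; rewrite nth_uniq //= ?inE ?negb_or.
    by move=> /eqP/ord_inj.
  by rewrite uv ab !neq // adj_sym.
move=> i j ij; have [ua' va' ub' vb'] : [/\ adj a u, adj a v, adj b u & adj b v].
  by split; rewrite adj_sym.
by case: i j ij => [[|[|[|[|]]]] //= ?] [[|[|[|[|]]]] //= ?].
Qed.

Lemma sum_nat_Cauchy (V : finType) (F : V -> nat) :
  ((\sum_v F v) ^ 2 <= #|V| * \sum_v F v ^ 2)%N.
Proof.
rewrite -(leq_pmul2l (isT : 0 < 2)%N).
have -> : (2 * (\sum_v F v) ^ 2 = \sum_v \sum_w 2 * (F v * F w))%N.
  rewrite expnS expn1 big_distrl big_distrr /=; apply: eq_bigr => v _.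
  by rewrite !big_distrr.
have -> : (2 * (#|V| * \sum_v F v ^ 2) = \sum_v \sum_w (F v ^ 2 + F w ^ 2))%N.
  rewrite mul2n -addnn.
  under [RHS]eq_bigr => v _ do rewrite big_split sum_nat_const /=.
  by rewrite big_split sum_nat_const -big_distrr.
by apply: leq_sum => v _; apply: leq_sum => w _; exact: (nat_Cauchy _ _).1.
Qed.

(** Oriented edges are sorted by the ordered pair of parts of their ends: none on the diagonal, one
    elsewhere. *)
Lemma nk_graph_sum_degree (n k : nat) (G : sgraph) : nk_graph n k G ->
  (\sum_(v : G) #|[set w | adj v w]| = n * n.-1)%N.
Proof.
move=> [part [_ part_in part_out]].
transitivity (\sum_(uv : G * G) (adj uv.1 uv.2 : nat))%N.
  rewrite -(pair_bigA _ (fun u v : G => adj u v : nat)) /=; apply: eq_bigr => v _.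
  by rewrite -sum1dep_card big_mkcond; apply: eq_bigr => w _; case: adj.
rewrite (partition_big (fun uv : G * G => (part uv.1, part uv.2)) xpredT) //=.
transitivity (\sum_(ij : 'I_n * 'I_n) (ij.1 != ij.2 : nat))%N.
  apply: eq_bigr => -[i j] _ /=; have [ij|ij] := eqVneq i j.
    rewrite big1 // => uv; rewrite xpair_eqE ij => /andP[/eqP Eu /eqP Ev].
    by rewrite (negPf (part_in _ _ _)) // Eu Ev.
  rewrite [RHS]/= -(part_out _ _ ij) -sum1dep_card big_mkcond [RHS]big_mkcond /=.
  apply: eq_bigr => uv _; rewrite xpair_eqE.
  by case: eqP => //=; case: eqP => //=; case: adj.
rewrite -(pair_bigA _ (fun i j : 'I_n => i != j : nat)) /=.
transitivity (\sum_(i < n) n.-1)%N; last by rewrite sum_nat_const card_ord.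
apply: eq_bigr => i _; rewrite -[in RHS](card_ord n) -(cardC1 i) -sum1_card.
rewrite [RHS]big_mkcond.
by apply: eq_bigr => j _; rewrite !inE eq_sym; case: eqP.
Qed.

Lemma nk_graph_card (n k : nat) (G : sgraph) :
  nk_graph n k G -> (#|G| <= n * k)%N.
Proof.
move=> [part [le_k _ _]]; rewrite -sum1_card (partition_big part xpredT) //=.
rewrite -[X in (_ <= X * _)%N]card_ord -sum_nat_const; apply: leq_sum => i _.
by rewrite sum1dep_card.
Qed.

Lemma nk_graph_codegree (n k m : nat) (G : sgraph) :
  (0 < m)%N -> nk_graph n k G ->
  (forall u v : G, u != v -> codegree u v <= m)%N -> (n <= m * k.+1 ^ 3)%N.
Proof.
move=> m_gt0 nkG codeg; have := nk_graph_card nkG.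
have := nk_graph_sum_degree nkG.
set N := #|G|; pose deg (v : G) := #|[set w | adj v w]|.
set E := (n * n.-1)%N => sumE leN.
(* Walks [u, v, u'] are counted by middle and by ends; those with [u = u'] number [E], and other
   pairs have at most [m] each. *)
have sumE2 : (\sum_v deg v ^ 2 <= E + m * N ^ 2)%N.
  have -> : (\sum_v deg v ^ 2 = \sum_(u : G) \sum_(u' : G) codegree u u')%N.
    pose c (u u' v : G) : nat := adj u v && adj u' v.
    transitivity (\sum_(v : G) \sum_(u : G) \sum_(u' : G) c u u' v)%N.
      apply: eq_bigr => v _; have -> : deg v = (\sum_(u : G) adj u v)%N.
        rewrite /deg -sum1dep_card big_mkcond; apply: eq_bigr => u _.
        by rewrite adj_sym; case: adj.
      rewrite expnS expn1 big_distrl; apply: eq_bigr => u _; rewrite big_distrr.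
      by apply: eq_bigr => u' _; rewrite /c; case: adj; case: adj.
    rewrite exchange_big; apply: eq_bigr => u _; rewrite exchange_big.
    apply: eq_bigr => u' _; rewrite /codegree -sum1dep_card [RHS]big_mkcond.
    by apply: eq_bigr => v _; rewrite /c; case: (_ && _).
  have -> : (m * N ^ 2 = \sum_(u : G) N * m)%N.
    by rewrite sum_nat_const expnS expn1 mulnC mulnA.
  rewrite -sumE -big_split /=.
  apply: leq_sum => u _; rewrite (bigD1 u) //= leq_add //.
    rewrite /codegree; apply/subset_leq_card/fintype.subsetP => w.
    by rewrite !inE andbb.
  apply: (@leq_trans (\sum_(v : G) m)%N); last by rewrite sum_nat_const.
  rewrite big_mkcond; apply: leq_sum => v _.
  by case: ifP => // vu; apply: codeg; rewrite eq_sym.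
have : (E ^ 2 <= N * (E + m * N ^ 2))%N.
  by rewrite -{1}sumE (leq_trans (sum_nat_Cauchy _)) // leq_mul2l sumE2 orbT.
move=> /leq_trans /(_ (leq_mul leN (leq_add (leqnn E) (leq_mul (leqnn m)
  (leq_mul leN leN))))).
(* After the shift to [n.+1], dividing by [n.+1 ^ 2] leaves [n ^ 2 <= k n + m (n + 1) k ^ 3], false
   once [n >= k + m k ^ 3 + 1]. *)
rewrite /E => bound; clear -m_gt0 bound; case: n bound => [//|n] /=.
rewrite leqNgt => H; rewrite leqNgt; apply/negP => lt_n; move/negP: H; apply.
set A := (m * k.+1 ^ 3)%N in lt_n.
have A_big : (k + m * k ^ 3 + 1 <= A)%N by rewrite /A; nia.
suff : (n.+1 ^ 2 * (k * n + m * n.+1 * k ^ 3) < n.+1 ^ 2 * n ^ 2)%N by nia.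
rewrite ltn_pmul2l ?expn_gt0 //; rewrite ltnS in lt_n.
have : ((k + m * k ^ 3 + 1) * n <= n * n)%N by rewrite leq_mul2r; lia.
have : (m * k ^ 3 < n)%N by lia.
rewrite -(mulnn n); set B := (m * k ^ 3)%N => h1 h2.
have -> : (m * n.+1 * k ^ 3 = B * n.+1)%N by rewrite /B; nia.
nia.
Qed.

(** * Asymptotics in the cube root of n *)

(** Here [a = 2 ^ j] with [8 ^ (j - 1) < n <= 8 ^ j], and [16 * b] is the cost of the recursion;
    cubing keeps the bounds in [nat]. *)
Lemma nk_free_exp8 (n : nat) (H : sgraph) : has_c4 H -> (1 < n)%N ->
  exists a b : nat, [/\ nk_free n H (a + 16 * b)%N, (a ^ 3 <= 8 * n)%N &
    (b ^ 3 <= 4 * a ^ 2)%N].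
Proof.
move=> c4H n_gt1; pose j := up_log 8 n.
have /andP[lt_n le_n] := up_log_bounds (isT : 1 < 8)%N n_gt1.
have j_gt0 : (0 < j)%N.
  by rewrite lt0n; apply: contraTneq le_n; rewrite -/j => ->; lia.
exists (2 ^ j)%N, (2 ^ ((2 * j + 2) %/ 3))%N; split.
- have [T cardT linkT] := linked_exp8 j_gt0.
  apply: (linked_nk_free c4H _ cardT); first by rewrite addn_gt0 expn_gt0.
  by apply: linked_card linkT; rewrite !card_ord.
- rewrite -expnM mulnC expnM -/(8 ^ j)%N -(prednK j_gt0) expnS leq_mul2l.
  exact: ltnW.
- by rewrite -!expnM -[4%N]/(2 ^ 2)%N -expnD leq_exp2l //; lia.
Qed.

Local Open Scope classical_set_scope.
Local Open Scope ring_scope.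

Lemma cvg_powR_inv (R : realType) (c x : R) : 0 < x ->
  c / n%:R `^ x @[n --> \oo] --> (0 : R).
Proof.
move=> x_gt0; apply/cvgr0Pnorm_lt => e e_gt0.
pose y := `|c| / e; have y_ge0 : 0 <= y by rewrite divr_ge0 // ltW.
near=> n; have lt_n : y `^ x^-1 < n%:R by near: n; exact: nbhs_infty_gtr.
have : y < n%:R `^ x.
  have yE : (y `^ x^-1) `^ x = y by rewrite -powRrM mulVf ?powRr1 ?lt0r_neq0.
  by rewrite -[ltLHS]yE gt0_ltr_powR ?nnegrE ?powR_ge0 ?ler0n.
move=> lt_y; have p_gt0 : 0 < n%:R `^ x by apply: le_lt_trans lt_y.
rewrite normrM normfV (gtr0_norm p_gt0) ltr_pdivrMr //.
by rewrite -ltr_pdivrMl // mulrC.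
Unshelve. all: by end_near. Qed.

Lemma f_root_bounds (R : realType) (n m : nat) (H : sgraph) :
  has_c4 H -> (0 < m)%N -> (1 < n)%N ->
  (forall G : sgraph, ~ contains_subgraph G H ->
     forall u v : G, u != v -> (codegree u v <= m)%N) ->
  let c := n%:R `^ 3^-1 : R in
  [/\ (0 < f n H)%N, (n <= m * (f n H).+1 ^ 3)%N &
      (f n H)%:R <= (2 + 48 / n%:R `^ 9^-1) * c].
Proof.
move=> c4H m_gt0 n_gt1 codeg c.
have [a [b [free_ab le_a le_b]]] := nk_free_exp8 c4H n_gt1.
have [[f_gt0 [G [nkG freeG]]] le_f] := f_min free_ab.
split=> //; first exact: nk_graph_codegree m_gt0 nkG (codeg G freeG).
(* In terms of this ninth root, [a <= 2 r ^ 3] and [b ^ 3 <= 4 a ^ 2 <= 16 r ^ 6 <= (3 r ^ 2) ^ 3];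
   hence [48 = 16 * 3]. *)
set r := n%:R `^ 9^-1 : R.
have n_gt0 : 0 < n%:R :> R by rewrite ltr0n ltnW.
have r_gt0 : 0 < r by exact: powR_gt0.
have root (k : nat) : (0 < k)%N -> (n%:R `^ k%:R^-1) ^+ k = n%:R :> R.
  move=> k_gt0; rewrite -powR_mulrn ?powR_ge0 // -powRrM mulVf ?powRr1 ?ltW //.
  by rewrite pnatr_eq0 -lt0n.
have cE : c = r ^+ 3.
  apply: (@pexpIrn _ 3) => //; rewrite ?nnegrE ?powR_ge0 ?exprn_ge0 ?(ltW r_gt0) //.
  by rewrite -exprM !root.
have le_a' : a%:R <= 2 * r ^+ 3.
  rewrite -(@ler_pXn2r _ 3) ?nnegrE ?mulr_ge0 ?exprn_ge0 ?(ltW r_gt0) //.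
  rewrite exprMn -exprM root // -!natrX -natrM ler_nat; exact: le_a.
have le_b' : b%:R <= 3 * r ^+ 2.
  rewrite -(@ler_pXn2r _ 3) ?nnegrE ?mulr_ge0 ?exprn_ge0 ?(ltW r_gt0) //.
  apply: (@le_trans _ _ (4 * a%:R ^+ 2)).
    by rewrite -!natrX -natrM ler_nat.
  apply: (@le_trans _ _ (4 * (2 * r ^+ 3) ^+ 2)).
    by rewrite ler_pM2l // ler_pXn2r ?nnegrE ?mulr_ge0 ?exprn_ge0 ?(ltW r_gt0).
  have : 0 <= r ^+ 6 by rewrite exprn_ge0 ?ltW.
  have -> : (3 * r ^+ 2) ^+ 3 = 27 * r ^+ 6 by ring.
  have -> : 4 * (2 * r ^+ 3) ^+ 2 = 16 * r ^+ 6 by ring.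
  lra.
have -> : (2 + 48 / r) * c = 2 * r ^+ 3 + 48 * r ^+ 2.
  by rewrite cE; field; rewrite gt_eqF.
apply: (@le_trans _ _ (a + 16 * b)%:R); first by rewrite ler_nat.
rewrite natrD natrM; lra.
Qed.

Lemma cube_root_le (R : realType) (n : nat) (x : R) : 0 <= x ->
  n%:R <= x ^+ 3 -> n%:R `^ 3^-1 <= x.
Proof.
move=> x_ge0 le_n; rewrite -(@ler_pXn2r _ 3) ?nnegrE ?powR_ge0 //.
by rewrite -powR_mulrn ?powR_ge0 // -powRrM mulVf ?powRr1.
Qed.

Theorem theorem1p4 (R : realType) :
  (forall t : nat, (2 <= t)%N ->
     exists C : R, 0 < C /\
     exists eps : nat -> R, eps n @[n --> \oo] --> (0 : R) /\
       \forall n \near \oo,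
         C * n%:R `^ (3%:R^-1) <= (f n (Kbip 2 t))%:R
         /\ (f n (Kbip 2 t))%:R <= (2%:R + eps n) * n%:R `^ (3%:R^-1))
  /\
  (exists eps1 eps2 : nat -> R,
     [/\ eps1 n @[n --> \oo] --> (0 : R),
         eps2 n @[n --> \oo] --> (0 : R) &
         \forall n \near \oo,
           (1 - eps1 n) * n%:R `^ (3%:R^-1) <= (f n C4)%:R
           /\ (f n C4)%:R <= (2%:R + eps2 n) * n%:R `^ (3%:R^-1)]).
Proof.
split.
  move=> [|[|t]] // _; pose m := t.+1.
  (* Since [f] and [m] are at least 1, [n <= m (f + 1) ^ 3] gives [n <= (2 m f) ^ 3]. *)
  exists (2 * m%:R)^-1; split; first by rewrite invr_gt0 mulr_gt0.
  exists (fun n => 48 / n%:R `^ 9^-1); split.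
    by apply: cvg_powR_inv; rewrite invr_gt0.
  near=> n; have n_gt1 : (1 < n)%N by near: n; exact: nbhs_infty_gt.
  have [||||f_gt0 le_n ub] := @f_root_bounds R n m (Kbip 2 m.+1) => //.
  - exact: has_c4_Kbip2.
  - by move=> G freeG u v; apply: codegree_Kbip2_free.
  split=> //; rewrite ler_pdivrMl ?mulr_gt0 //; apply: cube_root_le.
    by rewrite !mulr_ge0.
  rewrite -!natrM -natrX ler_nat (leq_trans le_n) //.
  rewrite [(2 * m)%N]mulnC -mulnA expnMn leq_mul //.
    by rewrite -[leqLHS]expn1 leq_pexp2l.
  by rewrite leq_exp2r // mul2n -addnn -addn1 leq_add2l.
(* For [m = 1] the bound is [n <= (f + 1) ^ 3]; the first error term absorbs the 1 in
   [n ^ (1/3) - 1 <= f]. *)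
exists (fun n => 1 / n%:R `^ 3^-1), (fun n => 48 / n%:R `^ 9^-1); split.
- by apply: cvg_powR_inv; rewrite invr_gt0.
- by apply: cvg_powR_inv; rewrite invr_gt0.
near=> n; have n_gt1 : (1 < n)%N by near: n; exact: nbhs_infty_gt.
have [||||f_gt0 le_n ub] := @f_root_bounds R n 1 C4 => //.
- exact: has_c4_C4.
- by move=> G freeG u v; apply: codegree_C4_free.
split=> //; rewrite mulrBl !mul1r mulVf ?gt_eqF ?powR_gt0 ?ltr0n ?(ltnW n_gt1) //.
rewrite lerBlDr; apply: cube_root_le; first by rewrite addr_ge0.
by rewrite natr1 -natrX ler_nat; rewrite mul1n in le_n.
Unshelve. all: by end_near. Qed.
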